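(* For every odd integer $n\ge 3$, $\mathcal{PD}^{TJ}(K^{2,3}(C_n))$ is isomorphic to the cycle $C_n$.
   Context: Graphs are finite and simple. $C_n$ denotes the cycle with $n$ vertices. For a connected graph $G$, $K^{2,3}(G)$ is the graph obtained from $G$ by deleting each edge $uv$ of $G$ and adding, for each deleted edge $uv$, three new vertices of degree 2, each adjacent to exactly $u$ and $v$. For a graph $G$ and a non-empty $S\subseteq V(G)$ define $P^0[S]=S$, $P^1[S]=N[S]$ (the union of the closed neighborhoods of vertices of $S$), and for $i\ge 2$, $P^i[S]=P^{i-1}[S]\cup\{u: N_G(v)\setminus P^{i-1}[S]=\{u\}\text{ for some }v\in P^{i-1}[S]\}$. $S$ is a power dominating set if $P^t[S]=V(G)$ for some $t$; it is minimum if it has the smallest cardinality among power dominating sets. The token jumping (TJ) reconfiguration graph $\mathcal{PD}^{TJ}(G)$ has as vertices all minimum power dominating sets of $G$, with $S$ and $S'$ adjacent if and only if $S$ is obtained from $S'$ by exchanging a single vertex, i.e. $|S\setminus S'|=|S'\setminus S|=1$. *)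

(* Defs.v *)
From mathcomp Require Import all_boot.
From mathcomp Require Import boolp.

Set Implicit Arguments.
Unset Strict Implicit.
Unset Printing Implicit Defensive.

Record sgraph := SGraph {
  svertex :> finType;
  adj : rel svertex;
  adj_sym : symmetric adj;
  adj_irrefl : irreflexive adj
}.

Definition graph_iso (G H : sgraph) : Prop :=
  exists f : G -> H, bijective f /\ forall x y, adj (f x) (f y) = adj x y.

Definition edge_set (G : sgraph) : {set {set G}} :=
  [set e | [exists u : G, exists v : G, adj u v && (e == [set u; v])]].

(* [ordS] is the successor modulo n. The condition [i != j] only matters for
   n = 1, where it removes the loop; the usual cycle is obtained for n >= 3. *)
Section Cycle.
Variable n : nat.

Definition cycle_adj : rel 'I_n :=
  fun i j => (i != j) && ((j == ordS i) || (i == ordS j)).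

Lemma cycle_adj_sym : symmetric cycle_adj.
Proof. by move=> i j; rewrite /cycle_adj eq_sym orbC. Qed.

Lemma cycle_adj_irrefl : irreflexive cycle_adj.
Proof. by move=> i; rewrite /cycle_adj eqxx. Qed.

Definition cycle_graph : sgraph := SGraph cycle_adj_sym cycle_adj_irrefl.
End Cycle.

(* The vertices are those of G, together with three copies [(e, k)] of each
   edge e, adjacent exactly to the two ends of e. No edge of G is kept. *)
Section K23.
Variable G : sgraph.

Definition K23_vertex : finType :=
  (G + {e : {set G} | e \in edge_set G} * 'I_3)%type.

Definition K23_adj : rel K23_vertex :=
  fun x y => match x, y with
  | inl v, inr (e, _) => v \in val e
  | inr (e, _), inl v => v \in val e
  | _, _ => false
  end.

Lemma K23_adj_sym : symmetric K23_adj.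
Proof. by move=> [u|[e k]] [v|[f l]]. Qed.

Lemma K23_adj_irrefl : irreflexive K23_adj.
Proof. by move=> [u|[e k]]. Qed.

Definition K23 : sgraph := SGraph K23_adj_sym K23_adj_irrefl.
End K23.

Section PowerDomination.
Variable G : sgraph.

Definition nbh (v : G) : {set G} := [set u | adj v u].

Definition closed_nbh (S : {set G}) : {set G} := \bigcup_(v in S) (v |: nbh v).

Definition propagate (T : {set G}) : {set G} :=
  T :|: [set u | [exists v in T, nbh v :\: T == [set u]]].

Fixpoint observed (S : {set G}) (i : nat) : {set G} :=
  match i with
  | 0 => S
  | 1 => closed_nbh S
  | i'.+1 => propagate (observed S i')
  end.

Definition power_dominating (S : {set G}) : Prop :=
  S != set0 /\ exists t, observed S t = setT.

Definition min_power_dominating (S : {set G}) : Prop :=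
  power_dominating S /\ forall T : {set G}, power_dominating T -> #|S| <= #|T|.

Definition min_pds : finType := {S : {set G} | `[< min_power_dominating S >]}.

Definition tj_adj : rel min_pds :=
  fun S T => (#|val S :\: val T| == 1) && (#|val T :\: val S| == 1).

Lemma tj_adj_sym : symmetric tj_adj.
Proof. by move=> S T; rewrite /tj_adj andbC. Qed.

Lemma tj_adj_irrefl : irreflexive tj_adj.
Proof. by move=> S; rewrite /tj_adj setDv cards0. Qed.

Definition PD_TJ : sgraph := SGraph tj_adj_sym tj_adj_irrefl.
End PowerDomination.

(* Main.v *)
Require Import Defs.
From mathcomp Require Import all_boot.
From mathcomp Require Import boolp zify.

(** In K^{2,3}(G), if neither end of an edge belongs to S, then two copies of
    that edge outside S block each other for ever: they have the same two
    neighbours, so neither is ever the only unobserved neighbour of an observed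
    vertex.  Hence a power dominating set contains an end of each edge or at
    least two of its three copies ([power_dominating_edge]).  Conversely, in a
    graph without isolated vertices, a nonempty vertex cover dominates all
    copies at once, and these then force the remaining old vertices
    ([power_dominating_vertex_cover]).

    On the cycle C_n, let a old vertices and c copies belong to S.  Every old
    vertex lies on two edges, so summing over the edges gives 4a + c >= 2n, that
    is 3a + #|S| >= 2n ([card_pds_cycle]).  As n is odd and a <= #|S|, the
    minimum of #|S| is (n + 1)/2 and copies only lose: the minimum power
    dominating sets are the vertex covers with (n + 1)/2 vertices
    ([min_power_dominating_cycleP]).

    Such a cover meets the n edges n + 1 times in total, so exactly one edge
    {j, j + 1} has both ends in it, and from there on membership alternates
    round the cycle ([tight_cover_alternating]).  This leaves n covers, one for
    each j.  The covers with doubled edges at i and j differ by one exchange if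
    and only if j = i + 2 or j = i - 2 ([card_alternating_coverD]), and since
    2 is invertible modulo the odd number n, relabelling j as 2i turns this
    relation into adjacency in C_n ([ahead_double_ord]). *)

Set Implicit Arguments.
Unset Strict Implicit.
Unset Printing Implicit Defensive.

(** * Minimum vertex covers of an odd cycle *)

Definition ahead n (j x : 'I_n) : nat := if j <= x then x - j else x + n - j.

(** The minimum vertex cover with doubled edge {j, j + 1}: the vertices j, j + 1,
    j + 3, ..., j + n - 2 when n is odd. *)
Definition alternating_cover n (j : 'I_n) : {set 'I_n} :=
  [set x | (ahead j x == 0) || odd (ahead j x)].

Definition ends_in n (A : {set 'I_n}) (x : 'I_n) : nat :=
  (x \in A) + (ordS x \in A).

Lemma ahead_ltn n (j x : 'I_n) : ahead j x < n.
Proof.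
have := (ltn_ord x, ltn_ord j) => -[xn jn].
by rewrite /ahead; case: (leqP j x); lia.
Qed.

Lemma ahead_eq0 n (j x : 'I_n) : (ahead j x == 0) = (x == j).
Proof.
rewrite /ahead -(inj_eq val_inj) /=; have := (ltn_ord x, ltn_ord j) => -[? ?].
by case: (leqP j x); lia.
Qed.

Lemma ahead_surj n (j : 'I_n) d : d < n -> exists x, ahead j x = d.
Proof.
move=> ltdn; have jn := ltn_ord j; case: (ltnP (j + d) n) => jd.
  exists (Ordinal jd); rewrite /ahead /=; case: leqP; lia.
have jd' : j + d - n < n by lia.
exists (Ordinal jd'); rewrite /ahead /=; case: leqP; lia.
Qed.

Lemma val_ordS n (x : 'I_n) : ordS x = (if x.+1 == n then 0 else x.+1) :> nat.
Proof.
rewrite /=; case: eqP => [->|ne]; first by rewrite modnn.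
by rewrite modn_small //; have := ltn_ord x; lia.
Qed.

Lemma ahead_ordS n (j x : 'I_n) :
  ahead j (ordS x) = if (ahead j x).+1 == n then 0 else (ahead j x).+1.
Proof.
have := (ltn_ord x, ltn_ord j); rewrite /ahead val_ordS => -[xn jn].
by case: (eqVneq x.+1 n) => ?; case: (leqP j x) => ?; case: leqP => ?;
  case: eqVneq; lia.
Qed.

Lemma ahead_trans n (i j x : 'I_n) :
  ahead j x = if ahead i j <= ahead i x then ahead i x - ahead i j
              else ahead i x + n - ahead i j.
Proof.
have := (ltn_ord x, ltn_ord j, ltn_ord i); rewrite /ahead => -[[xn jn] ni].
by case: (leqP j x) => ?; case: (leqP i x) => ?; case: (leqP i j) => ?;
  case: leqP; lia.
Qed.

Lemma ahead_inj n (j : 'I_n) : injective (ahead j).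
Proof.
move=> x y; have := (ltn_ord x, ltn_ord y, ltn_ord j); rewrite /ahead => -[[xn yn] jn].
by case: (leqP j x) => ?; case: (leqP j y) => ? e; apply: val_inj => /=; lia.
Qed.

(** The parity of the distance from j flips along every edge except the one that
    wraps round to j, from the even distance n - 1; putting distance 0 in the
    cover compensates there and makes {j, j + 1} the only doubled edge. *)
Lemma ends_in_alternating_cover n (j x : 'I_n) :
  odd n -> ends_in (alternating_cover j) x = 1 + (x == j).
Proof.
move=> oddn; rewrite /ends_in !inE -ahead_eq0 ahead_ordS.
have ltdn := ahead_ltn j x; move: (ahead j x) ltdn => d ltdn.
by case: (eqVneq d.+1 n) => /= eqd; case: (eqVneq d 0) => /= ?;
  case: (boolP (odd d)) => /= ?; lia.
Qed.

Lemma sum_ends_in n (A : {set 'I_n}) : \sum_x ends_in A x = #|A|.*2.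
Proof.
have sumA : \sum_x (x \in A) = #|A| by rewrite -sum1_card [RHS]big_mkcond.
rewrite big_split /= sumA -[in RHS]addnn -[in X in _ = _ + X]sumA.
by rewrite [in RHS](reindex (@ordS n)) //; apply/onW_bij/ordS_bij.
Qed.

Lemma card_alternating_cover n (j : 'I_n) :
  odd n -> #|alternating_cover j|.*2 = n.+1.
Proof.
move=> oddn; rewrite -sum_ends_in.
under eq_bigr => x _ do rewrite ends_in_alternating_cover //.
rewrite big_split /= sum1_card card_ord (bigD1 j) //= eqxx big1 ?addn1 //.
by move=> x /negPf ->.
Qed.

(** Along each edge the number of ends in the set together with membership of
    the first end determines membership of the second, so the agreement at j
    travels round the cycle. *)
Lemma ends_in_inj n (j : 'I_n) (A B : {set 'I_n}) :
  j \in A -> j \in B -> ends_in A =1 ends_in B -> A = B.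
Proof.
move=> jA jB eqAB; apply/setP => x; have [d] := ubnPeq (ahead j x).
elim: d x => [|d IHd] x; first by rewrite ahead_eq0 => /eqP ->; rewrite jA jB.
rewrite -(ord_predK x) ahead_ordS; move: (ord_pred x) => y.
case: (_ =P n) => // _; rewrite eqSS => /IHd.
by have := eqAB y; rewrite /ends_in; do 4 case: (_ \in _).
Qed.

Lemma alternating_cover_inj n : odd n -> injective (@alternating_cover n).
Proof.
move=> oddn i j eqC; apply/eqP.
have := ends_in_alternating_cover i i oddn.
by rewrite eqC ends_in_alternating_cover // eqxx; case: eqP.
Qed.

(** The excesses [(ends_in A x).-1] add up to (n + 1) - n = 1, so a single edge
    is covered twice, and its position determines A by [ends_in_inj]. *)
Lemma tight_cover_alternating n (A : {set 'I_n}) :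
  odd n -> (forall x, 0 < ends_in A x) -> #|A|.*2 = n.+1 ->
  exists j, A = alternating_cover j.
Proof.
move=> oddn covA cardA.
have /eqP/sum_nat_eq1 [j [_ j1 j0]] : \sum_x (ends_in A x).-1 = 1.
  apply: (@addnI n); rewrite addn1 -cardA -sum_ends_in.
  rewrite -[X in X + _ = _](card_ord n) -sum1_card -big_split /=.
  by apply: eq_bigr => x _; rewrite add1n prednK.
have endsA x : ends_in A x = 1 + (x == j).
  by rewrite -(prednK (covA x)); case: eqVneq => [->|/j0->//]; rewrite j1.
exists j; apply: (@ends_in_inj _ j) => [||x]; last first.
- by rewrite endsA ends_in_alternating_cover.
- by rewrite inE ahead_eq0 eqxx.
- by have := endsA j; rewrite /ends_in eqxx; case: (j \in A) => //; case: (_ \in A).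
Qed.

(** Write e for [ahead i j].  The parities of the distances from i and from j
    agree on one of the two arcs cut out by i and j and differ on the other.  So
    for even e the difference consists of the odd distances from i below e, and
    for odd e of 0 and the odd distances above e; its size is e/2 or
    (n - e)/2. *)
Lemma card_alternating_coverD n (i j : 'I_n) : 3 <= n -> odd n ->
  (#|alternating_cover i :\: alternating_cover j| == 1)
    = (ahead i j == 2) || (ahead i j == n - 2).
Proof.
move=> n3 oddn; have ijn := ahead_ltn i j.
have diff x : (x \in alternating_cover i :\: alternating_cover j) =
    ((ahead i x == 0) || odd (ahead i x)) &&
    ~~ ((ahead j x == 0) || odd (ahead j x)) by rewrite !inE andbC.
apply/idP/idP => [/cards1P [a Da]|].
  have two d1 d2 : d1 < d2 < n ->
      (forall x, ahead i x = d1 \/ ahead i x = d2 ->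
        x \in alternating_cover i :\: alternating_cover j) -> False.
    move=> /andP [lt12 lt2] memD; have [x1 e1] := ahead_surj i (ltn_trans lt12 lt2).
    have [x2 e2] := ahead_surj i lt2.
    have := (memD x1 (or_introl e1), memD x2 (or_intror e2)).
    rewrite Da !inE => -[/eqP x1a /eqP x2a].
    by rewrite -e1 -e2 x1a x2a ltnn in lt12.
  case: eqVneq => //= ij2; case: eqVneq => //= ijn2.
  (* An odd e other than n - 2 satisfies e + 2 < n, and an even e other than 0
     and 2 exceeds 3, which leaves room for two points in the difference. *)
  exfalso; case: (eqVneq (ahead i j) 0) => [e0|ne0].
    move/eqP: e0; rewrite ahead_eq0 => /eqP eji; have := set11 a.
    by rewrite -Da eji setDv inE.
  case: (boolP (odd (ahead i j))) => oddij.
    apply: (two 0 (ahead i j + 2)); first lia.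
    by move=> x; rewrite diff (ahead_trans i j x) => -[->|->]; case: leqP; lia.
  apply: (two 1 3); first lia.
  by move=> x; rewrite diff (ahead_trans i j x) => -[->|->]; case: leqP; lia.
case/orP => /eqP ij.
  have [a ia] : exists x, ahead i x = 1 by apply: ahead_surj; lia.
  apply/cards1P; exists a; apply/setP => x.
  rewrite diff inE -(inj_eq (@ahead_inj _ i)) ia (ahead_trans i j x) ij.
  by have lt := ahead_ltn i x; move: (ahead i x) lt => d lt; case: leqP; lia.
apply/cards1P; exists i; apply/setP => x.
rewrite diff inE -ahead_eq0 (ahead_trans i j x) ij.
by have lt := ahead_ltn i x; move: (ahead i x) lt => d lt; case: leqP; lia.
Qed.

Lemma double_ord_subproof n (i : 'I_n) : i.*2 %% n < n.
Proof. by rewrite ltn_pmod //; have := ltn_ord i; lia. Qed.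

Definition double_ord n (i : 'I_n) := Ordinal (double_ord_subproof i).

Lemma val_double_ord n (i : 'I_n) :
  double_ord i = (if i.*2 < n then i.*2 else i.*2 - n) :> nat.
Proof.
have lin := ltn_ord i; rewrite /=; case: ltnP => i2; first by rewrite modn_small.
by rewrite -{1}(subnK i2) modnDr modn_small //; lia.
Qed.

Lemma double_ord_inj n : odd n -> injective (@double_ord n).
Proof.
move=> oddn i j /(congr1 (@nat_of_ord n)).
have := (ltn_ord i, ltn_ord j) => -[ltin ltjn].
rewrite !val_double_ord.
by case: ltnP => ?; case: ltnP => ? eqij; apply: val_inj => /=; lia.
Qed.

Lemma double_ord_surj n (j : 'I_n) : odd n -> exists i, double_ord i = j.
Proof.
move=> oddn; have [g _ gK] := injF_bij (double_ord_inj oddn).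
by exists (g j); rewrite gK.
Qed.

(** Modulo n the left side says 2j = 2i + 2 or 2j = 2i - 2, and 2 cancels. *)
Lemma ahead_double_ord n (i j : 'I_n) : 3 <= n -> odd n ->
  (ahead (double_ord i) (double_ord j) == 2)
    || (ahead (double_ord i) (double_ord j) == n - 2) = cycle_adj i j.
Proof.
move=> n3 oddn; rewrite /cycle_adj -!(inj_eq (@ord_inj n)) !val_ordS.
rewrite /ahead !val_double_ord; have := (ltn_ord i, ltn_ord j) => -[ltin ltjn].
case: (ltnP i.*2 n) => ?; case: (ltnP j.*2 n) => ?; case: leqP => ?;
  case: (i.+1 =P n) => ?; case: (j.+1 =P n) => ?; lia.
Qed.

(** * Power domination when each edge is replaced by three paths *)

Definition old_part (G : sgraph) (S : {set K23 G}) : {set G} :=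
  [set u | (inl u : K23 G) \in S].

Definition copies (G : sgraph) (S : {set K23 G})
    (e : {e : {set G} | e \in edge_set G}) : {set 'I_3} :=
  [set k | (inr (e, k) : K23 G) \in S].

Definition old_vertices (G : sgraph) (A : {set G}) : {set K23 G} :=
  [set (inl u : K23 G) | u in A].

Lemma mem_edge_set (G : sgraph) (u v : G) : adj u v -> [set u; v] \in edge_set G.
Proof.
move=> uv; rewrite inE; apply/existsP; exists u; apply/existsP; exists v.
by rewrite uv /=.
Qed.

Lemma mem_old_vertices (G : sgraph) (A : {set G}) (u : G) :
  ((inl u : K23 G) \in old_vertices A) = (u \in A).
Proof. by rewrite mem_imset //; apply: inl_inj. Qed.

Lemma old_vertices_inj (G : sgraph) : injective (@old_vertices G).
Proof. by apply: imset_inj; apply: inl_inj. Qed.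

Lemma card_old_verticesD (G : sgraph) (A B : {set G}) :
  #|old_vertices A :\: old_vertices B| = #|A :\: B|.
Proof.
suff -> : old_vertices A :\: old_vertices B = old_vertices (A :\: B).
  by rewrite card_imset //; apply: inl_inj.
apply/setP => -[u|p]; first by rewrite inE !mem_old_vertices inE.
by rewrite inE andbC; apply/andP/imsetP => [[/imsetP []]|[]].
Qed.

(** Every neighbour of one of the two copies is a neighbour of the other, so it
    always has both of them unobserved and can force neither. *)
Lemma unobserved_copies (G : sgraph) (S : {set K23 G})
    (e : {e : {set G} | e \in edge_set G}) (k l : 'I_3) t :
    (forall v, v \in val e -> (inl v : K23 G) \notin S) ->
    k != l -> k \notin copies S e -> l \notin copies S e ->
  ((inr (e, k) : K23 G) \notin observed S t) &&
  ((inr (e, l) : K23 G) \notin observed S t).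
Proof.
rewrite !inE => noend neq_kl kS lS.
have closed1 m : (inr (e, m) : K23 G) \notin S ->
    (inr (e, m) : K23 G) \notin closed_nbh S.
  move=> mS; apply/bigcupP => -[[v vS|[f j] fS]]; rewrite !inE /=.
    by move=> ve; move: vS; rewrite (negPf (noend v ve)).
  by rewrite orbF => /eqP em; rewrite em fS in mS.
elim: t => [|[_|t /andP [IHk IHl]]]; first by rewrite kS.
  by rewrite !closed1.
have step (T : {set K23 G}) m m' : m != m' ->
    (inr (e, m) : K23 G) \notin T -> (inr (e, m') : K23 G) \notin T ->
    (inr (e, m) : K23 G) \notin propagate T.
  move=> neq mT m'T; rewrite !in_setU (negPf mT) inE /=.
  apply/existsP => -[w /andP [_ /eqP nbw]].
  have : (inr (e, m) : K23 G) \in nbh (w : K23 G) :\: T by rewrite nbw set11.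
  rewrite !inE mT; case: w nbw => [w|[f j] _ //] nbw we.
  have : (inr (e, m') : K23 G) \in nbh (inl w : K23 G) :\: T.
    by rewrite !inE m'T.
  by rewrite nbw inE => /eqP [em]; rewrite em eqxx in neq.
by apply/andP; split; [apply: (step _ k l)|apply: (step _ l k)]; rewrite // eq_sym.
Qed.

Lemma power_dominating_edge (G : sgraph) (S : {set K23 G})
    (e : {e : {set G} | e \in edge_set G}) : power_dominating S ->
  (exists2 v, v \in val e & v \in old_part S) \/ 1 < #|copies S e|.
Proof.
move=> [_ [t St]]; case: (ltnP 1 #|copies S e|) => [|few]; [by right|left].
have /card_gt1P [k [l [kS lS neq_kl]]] : 1 < #|~: copies S e|.
  by rewrite cardsCs setCK card_ord; lia.
rewrite !in_setC in kS lS.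
case: (boolP [exists v in val e, v \in old_part S]) => [/exists_inP //|].
move/exists_inPn => noend.
have noend' v : v \in val e -> (inl v : K23 G) \notin S.
  by move=> /noend; rewrite inE.
by have := unobserved_copies t noend' neq_kl kS lS; rewrite St !inE.
Qed.

(** After the domination step all copies are observed.  An unobserved old vertex
    v has a neighbour u in the cover, and a copy of the edge {v, u} then has v as
    its only unobserved neighbour. *)
Lemma power_dominating_vertex_cover (G : sgraph) (A : {set G}) :
    A != set0 -> (forall u : G, exists v, adj u v) ->
    (forall u v : G, adj u v -> (u \in A) || (v \in A)) ->
  power_dominating (old_vertices A).
Proof.
move=> A0 noiso covA; split.
  have [u uA] := set0Pn _ A0; apply/set0Pn; exists (inl u).
  by rewrite mem_old_vertices.
exists 2; rewrite [observed _ _]/=; set T := closed_nbh _.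
have oldT (u : G) : u \in A -> (inl u : K23 G) \in T.
  by move=> uA; apply/bigcupP; exists (inl u); rewrite ?mem_old_vertices ?setU11.
have copyT e k : (inr (e, k) : K23 G) \in T.
  have := valP e; rewrite inE => /existsP [u /existsP [v /andP [uv /eqP eE]]].
  have [x xe xA] : exists2 x, x \in val e & x \in A.
    rewrite eE; case/orP: (covA u v uv) => [uA|vA].
      by exists u; rewrite ?set21.
    by exists v; rewrite ?set22.
  by apply/bigcupP; exists (inl x); rewrite ?mem_old_vertices // !inE /= xe.
apply/setP => -[v|[e k]]; rewrite in_setU [in RHS]inE; last by rewrite copyT.
case: (boolP ((inl v : K23 G) \in T)) => //= vT.
have [u vu] := noiso v.
pose x : K23 G := inr (Sub [set v; u] (mem_edge_set vu), ord0).
rewrite inE; apply/exists_inP; exists x; first exact: copyT.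
have uA : u \in A by case/orP: (covA v u vu) => // /oldT; rewrite (negPf vT).
apply/eqP/setP => -[w|[f j]]; rewrite !inE /= ?andbF //.
rewrite !inE; case: (w =P v) => [->|nv]; first by rewrite vT eqxx.
case: (w =P u) => [wu|_].
  by rewrite wu oldT //=; apply/esym/negbTE/eqP => -[uv]; apply: nv; rewrite wu.
by rewrite andbF; apply/esym/negbTE/eqP => -[].
Qed.

Lemma card_K23_set (G : sgraph) (S : {set K23 G}) :
  #|S| = #|old_part S| + \sum_e #|copies S e|.
Proof.
have sum_mem (T : finType) (B : {set T}) : #|B| = \sum_x (x \in B).
  by rewrite -sum1_card [LHS]big_mkcond.
rewrite sum_mem big_sumType /= sum_mem; congr (_ + _).
  by apply: eq_bigr => u _; rewrite inE.
under [RHS]eq_bigr => e _ do rewrite sum_mem.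
by rewrite pair_big /=; apply: eq_bigr => -[e k] _; rewrite inE.
Qed.

(** * Minimum power dominating sets over a cycle *)

Lemma cycle_adj_ordS n (i : 'I_n) : 1 < n -> cycle_adj i (ordS i).
Proof.
move=> n1; rewrite /cycle_adj eqxx andbT -(inj_eq (@ord_inj n)) val_ordS.
by have := ltn_ord i; case: (i.+1 =P n); lia.
Qed.

(** For n = 2 both vertices give the same edge.  From 3 on no two do, so that a
    sum over i of a term in [h i] counts no edge twice. *)
Lemma cycle_edges n : 3 <= n ->
  exists2 h : 'I_n -> {e | e \in edge_set (cycle_graph n)},
    injective h & forall i, val (h i) = [set i; ordS i].
Proof.
move=> n3; have adjS (i : cycle_graph n) : adj i (ordS i).
  by apply: cycle_adj_ordS; lia.
exists (fun i => exist (fun e => e \in edge_set _) _ (mem_edge_set (adjS i))) => //.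
move=> i j [eij].
have := set21 i (ordS i); rewrite eij !inE; case: (i =P j) => //= _ /eqP ij.
have := set21 j (ordS j); rewrite -eij !inE ij => /orP.
rewrite -!(inj_eq (@ord_inj n)) !val_ordS; have := ltn_ord j.
case: (j.+1 =P n) => ? ? [/eqP|/eqP]; try lia.
all: case: eqP; lia.
Qed.

(** An edge with no end in S has at least two copies in S, so twice the number
    of ends plus the number of copies is at least 2 on each edge.  Summing gives
    4a + c >= 2n with a old vertices and c copies in S, and a + c = #|S|. *)
Lemma card_pds_cycle n (S : {set K23 (cycle_graph n)}) : 3 <= n ->
  power_dominating S -> 2 * n <= 3 * #|old_part S| + #|S|.
Proof.
move=> n3 pdS; have [h h_inj hE] := cycle_edges n3.
have edge_load i : 2 <= 2 * ends_in (old_part S) i + #|copies S (h i)|.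
  case: (power_dominating_edge (h i) pdS) => [[v]|]; last by lia.
  rewrite hE /ends_in !inE => /orP [] /eqP -> ->; lia.
have copies_le : \sum_i #|copies S (h i)| <= \sum_e #|copies S e|.
  rewrite -(big_imset (fun e => #|copies S e|)) /=; last by move=> ? ? _ _ /h_inj.
  by rewrite big_mkcond; apply: leq_sum => e _; case: ifP.
have : \sum_(i < n) 2 <= \sum_(i < n) (2 * ends_in (old_part S) i + #|copies S (h i)|).
  by apply: leq_sum => i _; apply: edge_load.
rewrite big_split -big_distrr sum_ends_in sum_nat_const card_ord /=.
have arith a c d : c <= d -> n * 2 <= 2 * a.*2 + c -> 2 * n <= 3 * a + (a + d).
  by lia.
by rewrite (card_K23_set S); apply: arith copies_le.
Qed.

(** With a = #|old_part S| <= #|S|, [card_pds_cycle] gives 4 #|S| >= 2n, hence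
    #|S| >= (n + 1)/2 for odd n, which the alternating covers attain.  For a
    minimum S it gives 3a >= 2n - (n + 1)/2, which forces a = (n + 1)/2, so S
    contains no copies and is a tight vertex cover. *)
Lemma min_power_dominating_cycleP n (S : {set K23 (cycle_graph n)}) :
    3 <= n -> odd n ->
  min_power_dominating S <-> exists j : 'I_n,
    S = old_vertices (alternating_cover j : {set cycle_graph n}).
Proof.
move=> n3 oddn.
pose C (j : 'I_n) := old_vertices (alternating_cover j : {set cycle_graph n}).
have cardC j : #|C j|.*2 = n.+1.
  by rewrite card_imset ?card_alternating_cover //; apply: inl_inj.
have pdC j : power_dominating (C j).
  apply: power_dominating_vertex_cover.
  - by apply/set0Pn; exists j; rewrite inE ahead_eq0 eqxx.
  - by move=> i; exists (ordS i); apply: cycle_adj_ordS; lia.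
  - have cov i : (i \in alternating_cover j) || (ordS i \in alternating_cover j).
      have := ends_in_alternating_cover j i oddn; rewrite /ends_in.
      by do 2 case: (_ \in _).
    by move=> u v /andP [_ /orP [] /eqP ->] //; rewrite orbC.
have old_le (T : {set K23 (cycle_graph n)}) : #|old_part T| <= #|T|.
  by rewrite card_K23_set leq_addr.
split=> [[pdS minS] | [j ->]]; last first.
  split=> [|T pdT]; first exact: pdC.
  have arith a c t : c.*2 = n.+1 -> a <= t -> 2 * n <= 3 * a + t -> c <= t by lia.
  exact: arith (cardC j) (old_le T) (card_pds_cycle n3 pdT).
have j0 : 'I_n by exists 0; lia.
have [cardA cardS] : #|old_part S|.*2 = n.+1 /\ #|S| = #|old_part S|.
  have arith a c s : c.*2 = n.+1 -> a <= s -> s <= c ->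
    2 * n <= 3 * a + s -> a.*2 = n.+1 /\ s = a by lia.
  exact: arith (cardC j0) (old_le S) (minS _ (pdC j0)) (card_pds_cycle n3 pdS).
have nocopy e : #|copies S e| = 0.
  have /eqP : \sum_e #|copies S e| = 0.
    by apply: (@addnI #|old_part S|); rewrite addn0 -card_K23_set.
  by rewrite sum_nat_eq0 => /forallP /(_ e) /eqP.
have [h h_inj hE] := cycle_edges n3.
have [j Aj] : exists j : 'I_n, old_part S = alternating_cover j.
  apply: tight_cover_alternating => // i.
  case: (power_dominating_edge (h i) pdS) => [[v]|]; last by rewrite nocopy.
  by rewrite hE /ends_in !inE => /orP [] /eqP -> ->; lia.
exists j; rewrite -Aj; apply/setP => -[u|[e k]].
  by rewrite mem_old_vertices inE.
have -> : ((inr (e, k) : K23 (cycle_graph n)) \in old_vertices (old_part S)) = false.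
  by apply/imsetP => -[].
by have /eqP := nocopy e; rewrite cards_eq0 => /eqP/setP/(_ k); rewrite !inE.
Qed.

Theorem proposition5p9 (n : nat) (n_ge3 : 3 <= n) (n_odd : odd n) :
  graph_iso (PD_TJ (K23 (cycle_graph n))) (cycle_graph n).
Proof.
pose C (j : 'I_n) := old_vertices (alternating_cover j : {set cycle_graph n}).
have minC j : `[< min_power_dominating (C j) >].
  by apply/asboolP/min_power_dominating_cycleP => //; exists j.
pose g (i : 'I_n) : min_pds (K23 (cycle_graph n)) :=
  exist (fun S => `[< min_power_dominating S >]) _ (minC (double_ord i)).
have g_inj : injective g.
  move=> i j /(congr1 val) /old_vertices_inj /(alternating_cover_inj n_odd).
  exact: double_ord_inj.
have g_surj S : exists i, g i == S.
  have /asboolP/(min_power_dominating_cycleP _ n_ge3 n_odd) [j Sj] := valP S.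
  have [i ij] := double_ord_surj j n_odd.
  by exists i; rewrite -(inj_eq val_inj) /= Sj -ij.
pose f S := sval (sigW (g_surj S)).
have fK : cancel f g by move=> S; apply/eqP; rewrite /f; case: sigW.
have gK : cancel g f by move=> i; apply: g_inj; rewrite fK.
exists f; split=> [|S T]; first by exists g.
have cardD i j : #|val (g i) :\: val (g j)| =
    #|alternating_cover (double_ord i) :\: alternating_cover (double_ord j)|.
  by rewrite card_old_verticesD.
rewrite -{2}(fK S) -{2}(fK T) /=; move: (f S) (f T) => i j.
rewrite /tj_adj !cardD !card_alternating_coverD // !ahead_double_ord //.
by rewrite [cycle_adj j i]cycle_adj_sym andbb.
Qed.
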